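(* Suppose $A$ is a finite set of real numbers such that $|\Delta(A\times A)|=O(|A|^2)$. Then there is a non-trivial line in $\mathbb{R}^2$ (in fact, there are many such lines) which contains $\Omega(|A|^{1/8})$ points of $A\times A$.
   Context: For a finite set of points $P\subset\mathbb{R}^2$, the set of (squared) distances spanned by $P$ is \[\Delta(P)=\{(p_1-q_1)^2+(p_2-q_2)^2:(p_1,p_2),(q_1,q_2)\in P\}.\] A line in $\mathbb{R}^2$ is called non-trivial if it is not parallel to either coordinate axis and is not the main diagonal $\{(x,y):y=x\}$. $|\cdot|$ denotes cardinality. The constant implied by $\Omega$ may depend on the constant implied by $O$ in the hypothesis. The number of lines meant by ''many'' is not quantified. *)

(* Defs.v *)
From HB Require Import structures.
From mathcomp Require Import all_boot all_order all_algebra finmap.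
From mathcomp Require Import all_classical all_reals exp.

Set Implicit Arguments.
Unset Strict Implicit.
Unset Printing Implicit Defensive.

Import Order.TTheory GRing.Theory Num.Theory.
Local Open Scope ring_scope.

Section Plane.
Variable R : realType.
Implicit Types (p q v : R * R) (L : set (R * R)).

Definition sqdist p q : R := (p.1 - q.1) ^+ 2 + (p.2 - q.2) ^+ 2.

(* Includes the distance 0 from each point to itself. *)
Definition distances (P : {fset R * R}) : {fset R} :=
  [fset sqdist p q | p in P, q in P]%fset.

Definition line_through p v : set (R * R) :=
  [set (p.1 + t * v.1, p.2 + t * v.2) | t in setT]%classic.

Definition is_line L : Prop :=
  exists p v, v != 0 /\ L = line_through p v.

(* A line is parallel to itself. *)
Definition parallel L L' : Prop :=
  exists p q v, [/\ v != 0, L = line_through p v & L' = line_through q v].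

Definition x_axis : set (R * R) := [set p | p.2 = 0]%classic.
Definition y_axis : set (R * R) := [set p | p.1 = 0]%classic.
Definition main_diagonal : set (R * R) := [set p | p.2 = p.1]%classic.

Definition nontrivial_line L : Prop :=
  [/\ is_line L, ~ parallel L x_axis, ~ parallel L y_axis
    & L <> main_diagonal].

Definition points_on (P : {fset R * R}) L : {fset R * R} :=
  [fset p in P | p \in L]%fset.

(* L is non-trivial and contains at least c |A|^(1/8) points of A x A. *)
Definition rich_line (c : R) (A : {fset R}) L : Prop :=
  nontrivial_line L /\
  c * (#|` A|%:R `^ (1 / 8)) <= #|` points_on (A `*` A)%fset L|%:R.

End Plane.

(* Main.v *)
Require Import Defs.
From mathcomp Require Import all_boot all_order all_algebra finmap.
From mathcomp Require Import all_classical all_reals exp.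
From mathcomp Require Import zify ring lra.

(** Put n for the number of positive differences of A, D for the set of squares
    of all differences, so that S := |Delta(A x A)| = |D + D|. The identity
      2(x - y)(z - w) =
        ((x - w)^2 + (y - z)^2) - ((x - z)^2 + (y - w)^2)
    places the (doubled) products of differences in (D + D) - (D + D), whose size
    P satisfies P n^3 <= S^4 by the Pluennecke-Ruzsa inequality. So the squares of
    the positive differences have few sums and few products, and Solymosi's
    sum-product argument gives n^5 <= 16 P^2 S^2, whence n^11 <= 16 S^10. For
    S = O(|A|^2) this is n = O(|A|^(20/11)), which is O(|A|^(15/8)): the lines
    y = x + t with t a positive difference of A are so few that, containing all
    the points of A x A above the diagonal, many of them must be rich. *)

Set Implicit Arguments.
Unset Strict Implicit.
Unset Printing Implicit Defensive.

Import Order.TTheory GRing.Theory Num.Theory.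
Local Open Scope ring_scope.

(** * Cardinalities of finite sets *)

Lemma cardfsX (T U : choiceType) (A : {fset T}) (B : {fset U}) :
  #|` (A `*` B)%fset| = (#|` A| * #|` B|)%N.
Proof.
rewrite card_fset_sum1 big_imfset2 /=; last by move=> [x y] [z t] /= _ _ [-> ->].
rewrite (eq_bigr (fun=> #|` B|)) => [|x _]; last by rewrite -card_fset_sum1.
by rewrite big_const_seq count_predT iter_addn_0 mulnC.
Qed.

Lemma leq_card_fset_in (T U : choiceType) (f : T -> U) (A : {fset T}) (B : {fset U}) :
  {in A &, injective f} -> (forall x, x \in A -> f x \in B) ->
  (#|` A| <= #|` B|)%N.
Proof.
move=> f_inj fAB.
have <- : #|` [fset f x | x in A]%fset| = #|` A| by rewrite card_in_imfset.
by apply: fsubset_leq_card; apply/fsubsetP => _ /imfsetP[x /= xA ->]; apply: fAB.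
Qed.

(** * The Pluennecke-Ruzsa inequality *)

Definition sumset (V : zmodType) (A B : {fset V}) : {fset V} :=
  [fset (x + y)%R | x in A, y in B]%fset.

Definition difset (V : zmodType) (A B : {fset V}) : {fset V} :=
  [fset (x - y)%R | x in A, y in B]%fset.

Section Plunnecke.
Variable V : zmodType.
Implicit Types A B C D X Y Z : {fset V}.

Lemma sumsetP A B z :
  reflect (exists x y, [/\ x \in A, y \in B & z = x + y]) (z \in sumset A B).
Proof.
apply: (iffP (imfset2P _ _ _ _ _)) => [[x xA [y yB ->]]|[x [y [xA yB ->]]]].
  by exists x, y.
by exists x => //; exists y.
Qed.

Lemma mem_sumset A B x y : x \in A -> y \in B -> x + y \in sumset A B.
Proof. by move=> xA yB; apply/sumsetP; exists x, y. Qed.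

Lemma difsetP A B z :
  reflect (exists x y, [/\ x \in A, y \in B & z = x - y]) (z \in difset A B).
Proof.
apply: (iffP (imfset2P _ _ _ _ _)) => [[x xA [y yB ->]]|[x [y [xA yB ->]]]].
  by exists x, y.
by exists x => //; exists y.
Qed.

Lemma sumset0 A : sumset A fset0 = fset0.
Proof. by apply/fsetP => z; rewrite inE; apply/sumsetP => -[x [y []]]. Qed.

Lemma sumsetSl A B C : (A `<=` B)%fset -> (sumset A C `<=` sumset B C)%fset.
Proof.
move=> /fsubsetP sAB; apply/fsubsetP => z /sumsetP[x [y [xA yC ->]]].
by rewrite mem_sumset ?sAB.
Qed.

Lemma sumsetA A B C : sumset A (sumset B C) = sumset (sumset A B) C.
Proof.
apply/fsetP => z; apply/sumsetP/sumsetP.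
  move=> [x [_ [xA /sumsetP[y [t [yB tC ->]]] ->]]].
  by exists (x + y), t; rewrite mem_sumset ?addrA.
move=> [_ [t [/sumsetP[x [y [xA yB ->]]] tC ->]]].
by exists x, (y + t); rewrite mem_sumset ?addrA.
Qed.

Lemma card_shift A c : #|` [fset (x + c)%R | x in A]%fset| = #|` A|.
Proof. by rewrite card_imfset //=; apply: addIr. Qed.

(** The minimized quantity is the ratio |X + B| / |X| over nonempty subsets of [A];
    cross-multiplying lets [Z] be empty as well. *)
Lemma exists_min_doubling A B : A != fset0 ->
  exists X, [/\ (X `<=` A)%fset, X != fset0 & forall Z, (Z `<=` A)%fset ->
    (#|` sumset X B| * #|` Z| <= #|` sumset Z B| * #|` X|)%N].
Proof.
move=> A0; have AA : A \in fpowerset A by rewrite fpowersetE.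
pose F (X : fpowerset A) : rat :=
  #|` sumset (val X) B|%:R / #|` val X|%:R.
pose P := [pred X : fpowerset A | val X != fset0].
have PA : P [` AA]%fset by [].
case: (arg_minP F PA) => X /= X0 minX.
exists (val X); split => //; first by rewrite -fpowersetE; apply: valP.
move=> Z; rewrite -fpowersetE => ZA.
have [->|Z0] := eqVneq Z fset0; first by rewrite cardfs0 muln0.
have /= := minX [` ZA]%fset Z0.
rewrite /F /= ler_pdivrMr ?ltr0n ?cardfs_gt0 //.
rewrite mulrAC ler_pdivlMr ?ltr0n ?cardfs_gt0 //.
by rewrite -!natrM ler_nat.
Qed.

(** Induction on [C]: a new element c enlarges X + B + C by at most |X + B| - |Z + B| and X + C by
    at least |X| - |Z|, for the set [Z] below. The hypothesis, applied to this [Z], compares the two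
    increments. *)
Lemma petridis X B C :
    (forall Z, (Z `<=` X)%fset ->
      (#|` sumset X B| * #|` Z| <= #|` sumset Z B| * #|` X|)%N) ->
  (#|` sumset (sumset X B) C| * #|` X| <= #|` sumset X B| * #|` sumset X C|)%N.
Proof.
move=> minX; elim/fset1U_rect: C => [|c C cC IH]; first by rewrite !sumset0 cardfs0 mul0n.
(* Passing from C to c |` C, the translates x + c + B with x in Z contribute
   nothing new to X + B + C. *)
pose Z := [fset x in X |
  (sumset [fset (x + c)%R] B `<=` sumset (sumset X B) C)%fset]%fset.
have ZX : (Z `<=` X)%fset by apply/fsubsetP => x; rewrite !inE => /andP[].
have ub : (#|` sumset (sumset X B) (c |` C)%fset| + #|` sumset Z B| <=
           #|` sumset (sumset X B) C| + #|` sumset X B|)%N.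
  pose Y := (sumset X B `\` sumset Z B)%fset.
  have cY : (#|` Y| + #|` sumset Z B| = #|` sumset X B|)%N.
    by rewrite cardfsDS ?sumsetSl // subnK // fsubset_leq_card ?sumsetSl.
  rewrite -cY addnA leq_add2r -(card_shift Y c).
  apply: leq_trans (leq_card_fsetU _ _).1; apply: fsubset_leq_card.
  apply/fsubsetP => z /sumsetP[y [d [yXB]]].
  rewrite !inE => /predU1P[->|dC] -> /=; last by rewrite mem_sumset.
  have [yZB|yZB] := boolP (y \in sumset Z B); last first.
    by apply/orP; right; apply/imfsetP; exists y; rewrite //= inE yZB.
  have /sumsetP[x [b [+ bB ->]]] := yZB.
  rewrite !inE => /andP[xX /= /fsubsetP sub]; apply/orP; left.
  by rewrite addrAC; apply/sub/mem_sumset; rewrite ?inE.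
have lb : (#|` sumset X C| + #|` X| <= #|` sumset X (c |` C)%fset| + #|` Z|)%N.
  pose Y := (X `\` Z)%fset.
  have cY : (#|` Y| + #|` Z| = #|` X|)%N.
    by rewrite cardfsDS // subnK // fsubset_leq_card.
  rewrite -cY addnA leq_add2r -(card_shift Y c).
  rewrite -cardfsUI; set I := (_ `&` _)%fset.
  (* If x + c = x' + c' with c' in [C], then x + c + b = x' + b + c' for all b in [B], which puts x
     in [Z]. *)
  have -> : I = fset0.
    apply/fsetP => z; rewrite !inE; apply/negP => /andP[+ /imfsetP[x /=]].
    rewrite inE => + /andP[xZ xX] zE; subst z => /sumsetP[x' [c' [x'X c'C e]]].
    move: xZ; rewrite !inE xX /= => /fsubsetP; apply => w.
    move=> /sumsetP[? [b []]] /fset1P-> bB ->.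
    by rewrite e addrAC !mem_sumset.
  rewrite cardfs0 addn0; apply: fsubset_leq_card.
  apply/fsubsetP => z; rewrite !inE => /orP[/sumsetP[x [d [xX dC ->]]]|].
    by rewrite mem_sumset // !inE dC orbT.
  move=> /imfsetP[x /=]; rewrite inE => /andP[_ xX] ->.
  by rewrite mem_sumset // !inE eqxx.
have := minX _ ZX; move: IH ub lb.
move: #|` _| #|` X| #|` sumset X B| #|` _| #|` Z| => L x k.
move: #|` _| #|` _| #|` _| => *.
nia.
Qed.

(** Fix one representation d = y - z of each difference. The map sending (x, d) to (x + y, x + z) is
    injective: subtracting the coordinates gives back d, hence y, hence x. *)
Lemma ruzsa_triangle X Y Z :
  (#|` X| * #|` difset Y Z| <= #|` sumset X Y| * #|` sumset X Z|)%N.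
Proof.
have /choice[r rP] d : exists p : V * V, d \in difset Y Z ->
    [/\ p.1 \in Y, p.2 \in Z & d = p.1 - p.2].
  have [/difsetP[y [z [yY zZ ->]]]|_] := boolP (d \in difset Y Z).
    by exists (y, z).
  by exists (0, 0).
rewrite -!cardfsX.
pose f (u : V * V) := (u.1 + (r u.2).1, u.1 + (r u.2).2).
apply: (leq_card_fset_in (f := f)) => [[x d] [x' d']|[x d]]; last first.
  by rewrite in_fsetM => /andP[/= xX /rP[? ? _]]; rewrite in_fsetM /= !mem_sumset.
rewrite !in_fsetM /= => /andP[_ dD] /andP[_ dD'] [e1 e2].
have [_ _ dE] := rP _ dD; have [_ _ dE'] := rP _ dD'.
have dd' : d = d'.
  rewrite dE dE'; have := congr2 (fun a b => a - b) e1 e2.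
  by rewrite /= [x + (r d).1]addrC [x' + (r d').1]addrC !addrKA.
by move: e1; rewrite -dd' => /addIr ->.
Qed.

(** Let [X] minimize |X + D| / |X| and let P be the size of the difference set. Petridis's lemma
    bounds X + D + D, and the triangle inequality then gives |X|^3 P <= |X + D|^4. Minimality yields
    |X + D| / |X| <= |D + D| / |D|, and |X| <= |D| finishes. *)
Lemma card_plunnecke D : (#|` difset (sumset D D) (sumset D D)| * #|` D| ^ 3
  <= #|` sumset D D| ^ 4)%N.
Proof.
have [->|D0] := eqVneq D fset0; first by rewrite cardfs0 muln0.
have [X [XD X0 minX]] := exists_min_doubling D D0.
have kn := minX _ (fsubset_refl D).
have ux : (#|` sumset (sumset X D) D| * #|` X| <=
    #|` sumset X D| * #|` sumset X D|)%N.
  by apply: petridis => Z ZX; apply/minX/(fsubset_trans ZX).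
have xP := ruzsa_triangle X (sumset D D) (sumset D D).
rewrite sumsetA in xP; have xn := fsubset_leq_card XD.
move: D0 X0 kn ux xP xn; rewrite -!cardfs_gt0.
move: #|` X| #|` D| #|` sumset D D| #|` sumset X D| => x n s k.
move: #|` _| #|` _| => P u n0 x0 kn ux xP xn.
rewrite -(leq_pmul2r (_ : 0 < x ^ 3 * n)%N) ?muln_gt0 ?expn_gt0 ?x0 //.
have h1 : (x ^ 3 * P <= k ^ 4)%N.
  apply: (@leq_trans ((u * x) ^ 2)).
    have -> : (x ^ 3 * P = x ^ 2 * (x * P))%N by ring.
    by rewrite expnMn [leqRHS]mulnC leq_mul2l -(mulnn u) xP orbT.
  have -> : (k ^ 4 = (k * k) ^ 2)%N by ring.
  by rewrite leq_exp2r.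
have h2 : (k ^ 4 * n ^ 4 <= s ^ 4 * x ^ 4)%N by rewrite -!expnMn leq_exp2r.
apply: (@leq_trans (k ^ 4 * n ^ 4)).
  have -> : (P * n ^ 3 * (x ^ 3 * n) = (x ^ 3 * P) * n ^ 4)%N by ring.
  by rewrite leq_mul2r h1 orbT.
apply: leq_trans h2 _; rewrite leq_mul2l; apply/orP; right.
by rewrite expnSr leq_mul2l xn orbT.
Qed.

End Plunnecke.

(** * Solymosi's sum-product argument *)

(** Cauchy-Schwarz against the constant 1: sum 2 c_i c_j <= c_i^2 + c_j^2 over all pairs. *)
Lemma sqr_sum_le (I : Type) (s : seq I) (c : I -> nat) :
  ((\sum_(i <- s) c i) ^ 2 <= size s * \sum_(i <- s) c i ^ 2)%N.
Proof.
have sum_const a : (\sum_(j <- s) a = size s * a)%N.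
  by rewrite big_const_seq count_predT iter_addn_0 mulnC.
rewrite -(leq_pmul2l (isT : 0 < 2)%N) -mulnn big_distrlr /=.
rewrite big_distrr /= (eq_bigr (fun i => \sum_(j <- s) 2 * (c i * c j)))%N; last first.
  by move=> i _; rewrite big_distrr.
apply: (@leq_trans (\sum_(i <- s) \sum_(j <- s) (c i ^ 2 + c j ^ 2))).
  by apply: leq_sum => i _; apply: leq_sum => j _; rewrite nat_Cauchy.
under eq_bigr => i _ do rewrite big_split /=.
by rewrite big_split /= exchange_big /= sum_const addnn mul2n.
Qed.

(** The double sum is the sum of the squared fibre sizes of [g], while the fibre sizes themselves
    add up to |U|. *)
Lemma sqr_card_le_energy (U : finType) (J : choiceType) (g : U -> J) (Z : {fset J}) :
    (forall u, g u \in Z) ->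
  (#|U| ^ 2 <= #|` Z| * \sum_u \sum_v (g u == g v))%N.
Proof.
move=> gZ; pose c z := (\sum_u (g u == z))%N.
have cZ (F : J -> nat) u : (\sum_(z <- Z) (g u == z) * F z = F (g u))%N.
  rewrite (big_fsetD1 (g u)) //= eqxx mul1n big_seq big1 ?addn0 // => z.
  by rewrite !inE => /andP[zu _]; rewrite eq_sym (negbTE zu).
have -> : #|U| = (\sum_(z <- Z) c z)%N.
  rewrite exchange_big /= -sum1_card; apply: eq_bigr => u _.
  by rewrite -[LHS](cZ (fun=> 1%N) u); apply: eq_bigr => z _; rewrite muln1.
have -> : (\sum_u \sum_v (g u == g v) = \sum_(z <- Z) c z ^ 2)%N.
  have -> : (\sum_(z <- Z) c z ^ 2 = \sum_(z <- Z) \sum_u (g u == z) * c z)%N.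
    by apply: eq_bigr => z _; rewrite -mulnn big_distrl.
  rewrite [RHS]exchange_big /=; apply: eq_bigr => u _; rewrite cZ.
  by apply: eq_bigr => v _; rewrite eq_sym.
exact: sqr_sum_le.
Qed.

Section Solymosi.
Variables (R : realFieldType) (T : finType) (f : T -> R).
Hypotheses (f_inj : injective f) (f_gt0 : forall x, 0 < f x).

(** The pair [u] stands for the point (f u.1, f u.2) of the open positive quadrant, and its slope
    for the line joining it to the origin. *)
Definition slope (u : T * T) : R := f u.2 / f u.1.

Definition slope_mult (u : T * T) : nat := #|[set v | slope v == slope u]|.

Lemma f_neq0 x : f x != 0.
Proof. by rewrite gt_eqF. Qed.

Lemma slopeK u : slope u * f u.1 = f u.2.
Proof. by rewrite divfK // gt_eqF. Qed.

Lemma slope_mult_le u : (slope_mult u <= #|T|)%N.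
Proof.
apply: leq_trans (max_card [set v.1 | v in [set v | slope v == slope u]]).
rewrite card_in_imset //.
move=> [x y] [x' y']; rewrite !inE => /eqP e /eqP e' /= xx'.
move: (slopeK (x, y)) (slopeK (x', y')); rewrite e e' /= xx' => -> /f_inj ->.
by [].
Qed.

(** Both sides are the multiplicative energy: f z / f x = f y / f w means f x f y = f z f w. *)
Lemma sum_slope_mult :
  (\sum_u slope_mult u =
   \sum_(u : T * T) \sum_(v : T * T) (f u.1 * f u.2 == f v.1 * f v.2)%R)%N.
Proof.
transitivity (\sum_x \sum_z \sum_w \sum_y (f x * f y == f z * f w)%R)%N.
  rewrite pair_bigA; apply: eq_bigr => -[x z] _ /=.
  rewrite pair_bigA /slope_mult -sum1dep_card big_mkcond /=.
  apply: eq_bigr => -[w y] _; rewrite /slope /=.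
  by rewrite eqr_div ?f_neq0 // [f y * _]mulrC; case: eqP.
rewrite [RHS](eq_bigr (fun u : T * T =>
    (\sum_z \sum_w (f u.1 * f u.2 == f z * f w)%R)%N)); last first.
  by move=> u _; rewrite pair_bigA.
rewrite -(pair_bigA _ (fun x y => \sum_z \sum_w (f x * f y == f z * f w)%R)%N) /=.
apply: eq_bigr => x _; rewrite [RHS]exchange_big; apply: eq_bigr => z _ /=.
by rewrite exchange_big.
Qed.

(* Adding a point of Q to a point of T x T on the next larger slope of Q gives a vector
   strictly between the two lines, so these sums determine their summands. The
   points of Q on the steepest line, at most #|T| of them, are left out. *)
Lemma solymosi_successive_slopes (Q : {set T * T}) (Y : {fset R}) (m P : nat) :
    (forall x y, f x + f y \in Y) ->
    (forall u, u \in Q -> (m <= P * slope_mult u)%N) ->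
  (m * #|Q| <= P * #|` Y| ^ 2 + m * #|T|)%N.
Proof.
move=> fY Qrich.
have [->|/set0Pn[q0 q0Q]] := eqVneq Q finset.set0; first by rewrite cards0 muln0.
case: (@arg_maxP _ _ _ q0 (mem Q) slope q0Q) => top /= topQ topmax.
pose Q' := [set u in Q | slope u != slope top].
have cQ : (#|Q| <= #|Q'| + #|T|)%N.
  rewrite -(cardsID [set v | slope v == slope top] Q) addnC leq_add //.
    by apply: subset_leq_card; apply/fintype.subsetP => u; rewrite !inE andbC.
  apply: leq_trans (slope_mult_le top).
  by apply: subset_leq_card; apply/fintype.subsetP => u; rewrite !inE => /andP[].
pose above u := [pred v | (v \in Q) && (slope u < slope v)].
pose next u := [arg min_(v < top | above u v) slope v]%O.
have nextP u : u \in Q' -> [/\ next u \in Q, slope u < slope (next u) &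
    forall v, v \in Q -> slope u < slope v -> slope (next u) <= slope v].
  rewrite inE => /andP[uQ ut].
  have at0 : above u top.
    by apply/andP; split; [exact: topQ | rewrite lt_neqAle ut; apply: topmax].
  rewrite /next; case: (arg_minP slope at0) => v /andP[vQ uv] vmin; split => //.
  by move=> w wQ uw; apply: vmin; rewrite /= wQ.
(* The second point may lie outside [Q]: every point on the next line counts, so u contributes
   [slope_mult (next u)], which is large because [next u] is in [Q]. *)
pose W := [set w : (T * T) * (T * T) | (w.1 \in Q') && (slope w.2 == slope (next w.1))].
have cW : (m * #|Q'| <= P * #|W|)%N.
  have -> : #|W| = (\sum_(u in Q') slope_mult (next u))%N.
    rewrite -sum1_card (eq_bigl (fun w : (T * T) * (T * T) =>
      (w.1 \in Q') && (slope w.2 == slope (next w.1)))) => [|w]; last by rewrite inE.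
    rewrite -(pair_big_dep (mem Q') (fun u v => slope v == slope (next u))
      (fun _ _ => 1%N)) /=.
    by apply: eq_bigr => u _; rewrite sum1dep_card.
  rewrite mulnC -sum_nat_const big_distrr /=; apply: leq_sum => u /nextP[nQ _ _].
  exact: Qrich.
suff WY : (#|W| <= #|` Y| ^ 2)%N.
  apply: (@leq_trans (m * (#|Q'| + #|T|))); first by rewrite leq_mul2l cQ orbT.
  by rewrite mulnDr leq_add2r (leq_trans cW) // leq_mul2l WY orbT.
have next_le u u' : u \in Q' -> u' \in Q' -> slope u <= slope u' ->
    slope (next u) <= slope (next u').
  move=> /nextP[_ _ min_u] /nextP[nQ lt_u' _] le_uu'.
  exact/min_u/(le_lt_trans le_uu').
have memW u v : ((u, v) \in W) = (u \in Q') && (slope v == slope (next u)).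
  by rewrite inE.
have slope_le u v u' v' : (u, v) \in W -> (u', v') \in W ->
    f u.1 + f v.1 = f u'.1 + f v'.1 -> f u.2 + f v.2 = f u'.2 + f v'.2 ->
    slope u <= slope u'.
  rewrite !memW -!(slopeK u) -!(slopeK v) -!(slopeK u') -!(slopeK v') /=.
  move=> /andP[uQ /eqP->] /andP[u'Q /eqP->] e1 e2.
  (* Otherwise slope u' < slope u, hence slope (next u') <= slope u. Then u + v lies strictly above
     the line of slope [slope u] through the origin, and u' + v' strictly below it. *)
  rewrite leNgt; apply/negP => lt_u'u.
  have [_ lt_u _] := nextP _ uQ; have [_ lt_u' min'] := nextP _ u'Q.
  have le_nu' : slope (next u') <= slope u by apply: min' => //; case/setIdP: uQ.
  have h1 : 0 < f v.1 * (slope (next u) - slope u) by rewrite mulr_gt0 ?subr_gt0.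
  have h2 : 0 < f u'.1 * (slope (next u') - slope u') by rewrite mulr_gt0 ?subr_gt0.
  have h3 : 0 <= (f u'.1 + f v'.1) * (slope u - slope (next u')).
    by rewrite mulr_ge0 ?subr_ge0 // addr_ge0 // ltW.
  have e3 := congr1 (fun x => x * slope u) e1; rewrite /= in e3; lra.
rewrite -mulnn -cardfsX -card_finset.
pose g (w : (T * T) * (T * T)) := (f w.1.1 + f w.2.1, f w.1.2 + f w.2.2).
apply: (leq_card_fset_in (f := g)) => [w w'|w _]; last by rewrite in_fsetM /= !fY.
rewrite !in_fset; case: w w' => u v [u' v'] wW wW' [e1 e2].
have suu' : slope u = slope u'.
  by apply: le_anti; rewrite (slope_le u v u' v') // (slope_le u' v' u v).
move: (wW) (wW'); rewrite !memW => /andP[uQ /eqP sv] /andP[u'Q /eqP sv'].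
have svv' : slope v = slope v'.
  by rewrite sv sv'; apply: le_anti; rewrite !next_le // suu'.
have [_ lt_u _] := nextP _ uQ; rewrite -sv in lt_u.
(* Both decompositions now use the same two lines, of distinct slopes, and so coincide. *)
have dv : f v.1 = f v'.1.
  have := e2; rewrite -(slopeK u) -(slopeK v) -(slopeK u') -(slopeK v').
  rewrite -suu' -svv' => e2'; have e3 := congr1 (fun x => x * slope u) e1.
  have /eqP : (f v.1 - f v'.1) * (slope v - slope u) = 0 by rewrite /= in e3; lra.
  by rewrite mulf_eq0 !subr_eq0 [_ == slope u]gt_eqF // orbF => /eqP.
have du : f u.1 = f u'.1 by move: e1; rewrite dv => /addIr.
have same x y : f x.1 = f y.1 -> slope x = slope y -> x = y.
  case: x y => x1 x2 [y1 y2] /= e s; congr pair; apply: f_inj => //.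
  by have := slopeK (x1, x2); rewrite s /= e -[f y1]/(f (y1, y2).1) slopeK.
by congr pair; apply: same.
Qed.

End Solymosi.

(** If n^2 < 4 P, then n^4 <= 16 P^2 and n <= S^2 suffice. Otherwise the loss 2 P n^3 from the
    steepest line is at most half of n^5 and is absorbed. *)
Lemma sum_product_arith (n P S q : nat) : (n <= S ^ 2)%N ->
  (n ^ 3 <= 2 * P * q)%N -> (n ^ 2 * q <= 2 * P * S ^ 2 + n ^ 2 * n)%N ->
  (n ^ 5 <= 16 * P ^ 2 * S ^ 2)%N.
Proof.
move=> nS h1 h2; have [lt4P|le4P] := ltnP (n ^ 2) (4 * P).
  have -> : (n ^ 5 = n ^ 4 * n)%N by ring.
  apply: leq_mul => //; have -> : (16 * P ^ 2 = (4 * P) ^ 2)%N by ring.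
  by rewrite (expnM n 2 2) leq_exp2r // ltnW.
have h3 : (n ^ 2 * n ^ 3 <= 2 * P * (2 * P * S ^ 2 + n ^ 2 * n))%N.
  apply: leq_trans (leq_mul (leqnn (n ^ 2)) h1) _.
  by rewrite mulnCA leq_mul2l h2 orbT.
have h4 : (4 * P * n ^ 3 <= n ^ 2 * n ^ 3)%N by rewrite leq_mul2r le4P orbT.
have e5 : (n ^ 5 = n ^ 2 * n ^ 3)%N by ring.
nia.
Qed.

(** Let n and P be the sizes of [X] and [Z]. Points on popular lines carry at least half of the
    multiplicative energy. A line has at most n points, so P times their number is at least n^3 / 2,
    and Solymosi's argument applies to them. *)
Lemma sum_product (R : realFieldType) (X Y Z : {fset R}) :
    (forall x, x \in X -> 0 < x) ->
    (forall x y, x \in X -> y \in X -> x + y \in Y) ->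
    (forall x y, x \in X -> y \in X -> x * y \in Z) ->
  (#|` X| ^ 5 <= 16 * #|` Z| ^ 2 * #|` Y| ^ 2)%N.
Proof.
move=> X_gt0 XY XZ; pose f (x : X) : R := val x.
have f_gt0 x : 0 < f x by apply: X_gt0; apply: valP.
have f_inj : injective f by apply: val_inj.
have cX : #|` X| = #|{: X}| by rewrite cardfE.
have nS : (#|` X| <= #|` Y| ^ 2)%N.
  have [->|/fset0Pn[x0 x0X]] := eqVneq X fset0; first by rewrite cardfs0.
  have nY : (#|` X| <= #|` Y|)%N.
    apply: (leq_card_fset_in (f := +%R x0)) => [x y _ _ /addrI //|x xX].
    exact: XY.
  have Y_gt0 : (0 < #|` Y|)%N.
    by apply: leq_trans nY; rewrite cardfs_gt0; apply/fset0Pn; exists x0.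
  by rewrite (leq_trans nY) // -mulnn leq_pmulr.
have [n0|n_gt0] := posnP #|` X|; first by rewrite n0.
pose n := #|` X|; pose P := #|` Z|.
(* 2 * P * slope_mult u >= n^2 says that the line through u has at least half the
   average multiplicity n^2 / P predicted by the multiplicative energy. *)
pose Q := [set u : X * X | n ^ 2 <= 2 * P * slope_mult f u]%N.
apply: (@sum_product_arith _ _ _ #|Q|) nS _ _; last first.
  rewrite {3}cX; apply: (solymosi_successive_slopes f_inj f_gt0).
    by move=> x y; apply: XY; apply: valP.
  by move=> u; rewrite inE.
have en : (#|{: X * X}| ^ 2 <= P * \sum_u slope_mult f u)%N.
  rewrite (sum_slope_mult f_gt0).
  apply: (sqr_card_le_energy (g := fun u : X * X => f u.1 * f u.2)) => u.
  by apply: XZ; apply: valP.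
rewrite card_prod -cX in en.
rewrite -(leq_pmul2r n_gt0) -/n.
rewrite (bigID (mem Q)) /= in en.
have h1 : (\sum_(u in Q) slope_mult f u <= #|Q| * n)%N.
  rewrite -sum_nat_const; apply: leq_sum => u _; rewrite /n cX.
  exact: slope_mult_le.
have h2 : (2 * P * \sum_(u | u \notin Q) slope_mult f u <= n * n * n ^ 2)%N.
  rewrite big_distrr /= /n [X in (_ <= X * X * _)%N]cX -card_prod -sum_nat_const.
  rewrite big_mkcond /=; apply: leq_sum => u _; case: ifP => //.
  by rewrite inE -ltnNge => /ltnW.
have h3 := leq_mul (leqnn (2 * P)) h1.
move: en h2 h3; rewrite -/n -/P.
move: (\sum_(u in Q) _)%N (\sum_(u | _) _)%N => s t en h2 h3.
have e4 : ((n * n) ^ 2 = n ^ 3 * n)%N by ring.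
have e4' : (n * n * n ^ 2 = n ^ 3 * n)%N by ring.
nia.
Qed.

(** * Distances and shifts of the diagonal *)

Section Distances.
Variable R : realType.
Implicit Types (A : {fset R}) (a b m t : R).

(** On positive differences squaring is injective, their squares are positive as Solymosi's argument
    requires, and the lines y = x + t avoid the main diagonal. *)
Definition posdiff A : {fset R} := [fset t in difset A A | 0 < t]%fset.

Lemma posdiffP A t :
  reflect (exists a b, [/\ a \in A, b \in A, a < b & t = b - a]) (t \in posdiff A).
Proof.
rewrite !inE /=; apply: (iffP andP) => [[/difsetP[b [a [bA aA ->]]]]|[a [b [aA bA ab ->]]]].
  by rewrite subr_gt0; exists a, b.
by rewrite subr_gt0; split => //; apply/difsetP; exists b, a.
Qed.

Lemma distancesE A : distances (A `*` A)%fset =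
  sumset [fset t ^+ 2 | t in difset A A]%fset [fset t ^+ 2 | t in difset A A]%fset.
Proof.
apply/fsetP => z; apply/imfset2P/sumsetP => /=.
  move=> [[a b]]; rewrite in_fsetM /= => /andP[aA bA] [[c d]].
  rewrite in_fsetM /= => /andP[cA dA] ->; exists ((a - c) ^+ 2), ((b - d) ^+ 2).
  by split=> //; apply/imfsetP; [exists (a - c) | exists (b - d)] => //;
     apply/difsetP; [exists a, c | exists b, d].
move=> [_ [_ [/imfsetP[/= s + ->] /imfsetP[/= t + ->] ->]]].
move=> /difsetP[a [c [aA cA ->]]] /difsetP[b [d [bA dA ->]]].
by exists (a, b); rewrite ?in_fsetM ?aA //; exists (c, d); rewrite ?in_fsetM ?cA.
Qed.

Lemma mem_distances A a b c d : a \in A -> b \in A -> c \in A -> d \in A ->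
  (a - c) ^+ 2 + (b - d) ^+ 2 \in distances (A `*` A)%fset.
Proof.
move=> aA bA cA dA; apply/imfset2P; exists (a, b); first by rewrite in_fsetM /= aA.
by exists (c, d); rewrite ?in_fsetM /= ?cA.
Qed.

Lemma sqr_inj_posdiff A : {in posdiff A &, injective (fun t : R => t ^+ 2)}.
Proof.
move=> s t; rewrite !inE => /andP[_ s0] /andP[_ t0] /eqP.
by rewrite eqrXn2 // ?ltW // => /eqP.
Qed.

Lemma card_posdiff_le A :
  (#|` posdiff A| ^ 11 <= 16 * #|` distances (A `*` A)%fset| ^ 10)%N.
Proof.
set Y := distances _; pose n := #|` posdiff A|.
pose D : {fset R} := [fset t ^+ 2 | t in difset A A]%fset.
pose X : {fset R} := [fset t ^+ 2 | t in posdiff A]%fset.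
have cX : #|` X| = n by rewrite card_in_imfset //; apply: sqr_inj_posdiff.
have nD : (n <= #|` D|)%N.
  rewrite -cX; apply: fsubset_leq_card; apply/fsubsetP => _ /imfsetP[t /= + ->].
  by rewrite inE => /andP[tA _]; apply/imfsetP; exists t.
have P_le : (#|` difset Y Y| * n ^ 3 <= #|` Y| ^ 4)%N.
  have := card_plunnecke D; rewrite -distancesE -/Y; apply: leq_trans.
  by rewrite leq_mul2l leq_exp2r // nD orbT.
(* Halving undoes the factor 2 in the identity 2(x - y)(z - w) = w, with w in Y - Y; squaring gives
   the product of two elements of [X]. *)
pose Z : {fset R} := [fset (w / 2) ^+ 2 | w in difset Y Y]%fset.
have ZP : (#|` Z| <= #|` difset Y Y|)%N by apply: leq_imfset_card.
have n5 : (n ^ 5 <= 16 * #|` Z| ^ 2 * #|` Y| ^ 2)%N.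
  rewrite -cX; apply: sum_product.
  - by move=> _ /imfsetP[t /= + ->]; rewrite inE => /andP[_ /= t0]; rewrite exprn_gt0.
  - move=> _ _ /imfsetP[s /= /posdiffP[a [b [aA bA _ ->]]] ->]
      /imfsetP[t /= /posdiffP[c [d [cA dA _ ->]]] ->].
    exact: mem_distances.
  - move=> _ _ /imfsetP[s /= /posdiffP[y [x [yA xA _ ->]]] ->]
      /imfsetP[t /= /posdiffP[w [z [wA zA _ ->]]] ->].
    apply/imfsetP; exists (2 * ((x - y) * (z - w))) => /=; last by field.
    apply/difsetP; exists ((x - w) ^+ 2 + (y - z) ^+ 2).
    exists ((x - z) ^+ 2 + (y - w) ^+ 2).
    by split; [exact: mem_distances | exact: mem_distances | ring].
(* Six of the eleven factors n are spent on the square of P n^3 <= S^4. *)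
rewrite -/n; have -> : (n ^ 11 = n ^ 5 * n ^ 6)%N by ring.
apply: (leq_trans (leq_mul n5 (leqnn _))).
set S := #|` Y| in P_le n5 *; set P := #|` difset _ _| in ZP P_le.
apply: (@leq_trans (16 * S ^ 2 * (P * n ^ 3) ^ 2)).
  have -> : (16 * S ^ 2 * (P * n ^ 3) ^ 2 = 16 * P ^ 2 * S ^ 2 * n ^ 6)%N by ring.
  by rewrite !leq_mul // leq_exp2r.
have -> : (16 * S ^ 10 = 16 * S ^ 2 * (S ^ 4) ^ 2)%N by ring.
by rewrite leq_mul // leq_exp2r.
Qed.

(** * Non-vertical lines *)

Definition graph_line (m b : R) : set (R * R) := line_through (0, b) (1, m).

Lemma graph_lineE m b p : graph_line m b p <-> p.2 = m * p.1 + b.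
Proof.
split=> [[t _ <-] /=|e]; first by rewrite mulr1 add0r addrC mulrC.
by exists p.1 => //=; rewrite mulr1 add0r addrC mulrC -e -surjective_pairing.
Qed.

Lemma graph_line_nontrivial m b : m != 0 -> (m != 1) || (b != 0) ->
  nontrivial_line (graph_line m b).
Proof.
move=> m0 mb; split.
- by exists (0, b), (1, m); split => //; rewrite xpair_eqE oner_eq0.
- move=> [p [q [v [v0 Lp xq]]]].
  (* The parameters 0 and 1 show that a direction of the axis is horizontal. The points of abscissa
     0 and 1 on the line would then have equal ordinates, forcing m = 0. *)
  have v2 : v.2 = 0.
    have : x_axis (q.1 + 0 * v.1, q.2 + 0 * v.2) by rewrite xq; exists 0.
    have : x_axis (q.1 + 1 * v.1, q.2 + 1 * v.2) by rewrite xq; exists 1.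
    by rewrite /x_axis /= => ? ?; lra.
  have : graph_line m b (0, b) by apply/graph_lineE; rewrite /= mulr0 add0r.
  have : graph_line m b (1, m + b) by apply/graph_lineE; rewrite /= mulr1.
  rewrite Lp => -[s _ [_ /esym es]] [t _ [_ /esym et]].
  by rewrite v2 in es et; move/eqP: m0; apply; clear Lp xq; lra.
- move=> [p [q [v [v0 Lp yq]]]].
  have v1 : v.1 = 0.
    have : y_axis (q.1 + 0 * v.1, q.2 + 0 * v.2) by rewrite yq; exists 0.
    have : y_axis (q.1 + 1 * v.1, q.2 + 1 * v.2) by rewrite yq; exists 1.
    by rewrite /y_axis /= => ? ?; lra.
  have : graph_line m b (0, b) by apply/graph_lineE; rewrite /= mulr0 add0r.
  have : graph_line m b (1, m + b) by apply/graph_lineE; rewrite /= mulr1.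
  rewrite Lp => -[s _ [/esym es _]] [t _ [/esym et _]].
  by rewrite v1 in es et; clear Lp yq; lra.
- move=> Ld.
  have /graph_lineE /= e0 : graph_line m b (0, 0) by rewrite Ld.
  have /graph_lineE /= e1 : graph_line m b (1, 1) by rewrite Ld.
  by clear Ld; move/orP: mb => -[/eqP|/eqP]; apply; lra.
Qed.

(** * Points of A x A on lines of slope 1 *)

Definition line_mult A (t : R) : nat :=
  #|` points_on (A `*` A)%fset (graph_line 1 t)|.

Lemma line_multE A t : line_mult A t = (\sum_(a <- A) \sum_(b <- A) (b == a + t)%R)%N.
Proof.
rewrite /line_mult card_fset_sum1 /points_on -big_fset_condE big_mkcond /=.
rewrite big_imfset2 /=; last by move=> [x y] [z w] /= _ _ [-> ->].
apply: eq_bigr => a _; apply: eq_bigr => b _.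
suff -> : ((a, b) \in graph_line 1 t) = (b == a + t) by case: eqP.
apply/idP/eqP => [/set_mem/graph_lineE|e]; first by rewrite /= mul1r.
by apply/mem_set/graph_lineE; rewrite /= mul1r.
Qed.

Lemma line_mult_le A t : (line_mult A t <= #|` A|)%N.
Proof.
apply: (leq_card_fset_in (f := fst)) => [[a b] [a' b']|[a b]]; last first.
  by rewrite !inE /= => /andP[/andP[]].
rewrite !inE /= => /andP[_ /set_mem/graph_lineE e].
by move=> /andP[_ /set_mem/graph_lineE e'] aa'; move: e e'; rewrite /= aa' => -> ->.
Qed.

(** Each point (a, b) with a < b lies on exactly one of the lines, that of t = b - a. Swapping
    coordinates matches the points above the diagonal with those below, and the diagonal has |A|
    points. *)
Lemma sum_line_mult A :
  (2 * \sum_(t <- posdiff A) line_mult A t + #|` A| = #|` A| ^ 2)%N.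
Proof.
have -> : (\sum_(t <- posdiff A) line_mult A t =
           \sum_(a <- A) \sum_(b <- A) (a < b)%R)%N.
  under eq_bigr => t _ do rewrite line_multE.
  rewrite exchange_big /= big_seq [RHS]big_seq; apply: eq_bigr => a aA.
  rewrite exchange_big /= big_seq [RHS]big_seq; apply: eq_bigr => b bA.
  have [ab|ab] := ltP a b; last first.
    rewrite big_seq big1 // => t /posdiffP[c [d [_ _ cd ->]]].
    by case: eqP => // e; exfalso; lra.
  have tT : b - a \in posdiff A by apply/posdiffP; exists a, b.
  rewrite (big_fsetD1 (b - a)) //= [a + _]addrC subrK eqxx big_seq big1 // => t.
  by rewrite !inE => /andP[ne _]; case: eqP => // e; move/eqP: ne => []; lra.
have diag : #|` A| = (\sum_(a <- A) \sum_(b <- A) (a == b)%R)%N.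
  rewrite card_fset_sum1 big_seq [RHS]big_seq; apply: eq_bigr => a aA.
  rewrite (big_fsetD1 a) //= eqxx big_seq big1 // => b.
  by rewrite !inE eq_sym => /andP[/negbTE->].
rewrite -mulnn -cardfsX (card_fset_sum1 (A `*` A)%fset) big_imfset2 /=; last first.
  by move=> [x y] [z w] /= _ _ [-> ->].
rewrite mul2n -addnn {2}exchange_big /= diag -!big_split /=.
apply: eq_bigr => a _; rewrite -!big_split /=; apply: eq_bigr => b _.
by case: ltgtP.
Qed.

Lemma rich_graph_line A (c t : R) : t \in posdiff A ->
  c * #|` A|%:R `^ (1 / 8) <= (line_mult A t)%:R -> rich_line c A (graph_line 1 t).
Proof.
move=> tT rich; split=> //; apply: graph_line_nontrivial; first exact: oner_neq0.
by move: tT; rewrite inE => /andP[_ /gt_eqF->]; rewrite orbT.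
Qed.

Lemma graph_line_inj m : injective (graph_line m).
Proof.
move=> b b' e.
have : graph_line m b (0, b) by apply/graph_lineE; rewrite /= mulr0 add0r.
by rewrite e => /graph_lineE /=; rewrite mulr0 add0r.
Qed.

(** There is no positive difference here, and the line of slope 1 through (a, a) is the main
    diagonal; slope 2 is used instead. *)
Lemma rich_line_card_le1 A c : c <= 1 -> (#|` A| <= 1)%N ->
  exists L : set (R * R), rich_line c A L.
Proof.
move=> c1; have nt a : nontrivial_line (graph_line 2 (- a)).
  by apply: graph_line_nontrivial; rewrite ?pnatr_eq0 // (eqr_nat R 2 1).
case: (posnP #|` A|) => [A0 _|A0 A1].
  exists (graph_line 2 (- 0)); split=> //.
  by rewrite A0 powR0 ?mulr0 ?ler0n //; apply/negP => /eqP; lra.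
have /cardfs1P[a AE] : #|` A| == 1%N by rewrite eqn_leq A0 A1.
exists (graph_line 2 (- a)); split=> //.
rewrite AE cardfs1 powR1 mulr1 (le_trans c1) // ler1n cardfs_gt0.
apply/fset0Pn; exists (a, a); rewrite !inE /= eqxx /=.
by apply/mem_set/graph_lineE => /=; lra.
Qed.

(** The exponent 1/8 enters here. With w = |A|^(1/8) and n positive differences, n^11 <= 16 K^10
    w^160 <= (C w^15)^11, so n w <= C w^16 = C |A|^2. *)
Lemma posdiff_bound (K : R) : exists2 C : R, 0 < C & forall A, (0 < #|` A|)%N ->
  #|` distances (A `*` A)%fset|%:R <= K * #|` A|%:R ^+ 2 ->
  #|` posdiff A|%:R * #|` A|%:R `^ (1 / 8) <= C * #|` A|%:R ^+ 2.
Proof.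
(* The maximum with 1 ensures C <= C^11 when the eleventh root is taken. *)
pose C : R := Num.max 1 (16 * K ^+ 10); have C1 : 1 <= C by rewrite le_max lexx.
have C0 : 0 < C by apply: lt_le_trans C1.
exists C => // A A_gt0; set N : R := #|` A|%:R; set S : R := #|` distances _|%:R => SK.
have N1 : 1 <= N by rewrite ler1n.
pose w := N `^ (1 / 8); rewrite -/w.
have w8 : w ^+ 8 = N.
  rewrite -powR_mulrn ?powR_ge0 // -powRrM (_ : 1 / 8 * _ = 1) ?powRr1 ?ler0n //.
  by field.
have w1 : 1 <= w by rewrite -(powRr0 N) ler_powR //; lra.
have w0 : 0 < w by apply: lt_le_trans w1.
have : #|` posdiff A|%:R ^+ 11 <= 16 * S ^+ 10.
  by rewrite -!natrX -[16%:R]/(16%:R) -natrM ler_nat card_posdiff_le.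
move: #|` posdiff A|%:R (ler0n R #|` posdiff A|) => n n0 n11.
have S10 : S ^+ 10 <= (K * N ^+ 2) ^+ 10.
  by apply: lerXn2r; rewrite ?nnegrE ?ler0n // (le_trans _ SK) ?ler0n.
have n_le : n <= C * w ^+ 15.
  rewrite -(ler_pXn2r (_ : (0 < 11)%N)) ?nnegrE ?mulr_ge0 ?exprn_ge0 ?(ltW w0) ?(ltW C0) //.
  apply: (le_trans n11); apply: (@le_trans _ _ (C * w ^+ 160)).
    apply: (@le_trans _ _ (16 * (K * N ^+ 2) ^+ 10)); first by rewrite ler_pM2l.
    rewrite exprMn mulrA -w8 -!exprM; apply: ler_wpM2r; first by rewrite exprn_ge0 ?ltW.
    by rewrite le_max lexx orbT.
  rewrite exprMn -exprM; apply: ler_pM; rewrite ?exprn_ge0 ?(ltW w0) ?(ltW C0) //.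
    by rewrite ler_eXnr.
  by rewrite ler_weXn2l.
rewrite -w8 -exprM (_ : (8 * 2 = 15 + 1)%N) // exprD expr1 mulrA.
by rewrite ler_pM2r.
Qed.

Definition rich_shifts A (c : R) : {fset R} :=
  [fset t in posdiff A | c * #|` A|%:R `^ (1 / 8) <= (line_mult A t)%:R]%fset.

(** With N = |A| and k rich shifts, the lines hold (N^2 - N) / 2 points in total. Rich lines hold at
    most N each, and the others together at most c C N^2 <= N^2 / 8; divide (N^2 - N) / 2 <= k N +
    N^2 / 8 by N. The number of rich lines is thus linear in N. *)
Lemma card_rich_shifts A (c C : R) : 0 < c -> c * C <= 1 / 8 ->
    #|` posdiff A|%:R * #|` A|%:R `^ (1 / 8) <= C * #|` A|%:R ^+ 2 ->
  (3 * #|` A| <= 8 * #|` rich_shifts A c| + 4)%N.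
Proof.
move=> c0 cC nC; set N := #|` A|; set k := #|` _|.
have [N0|N_gt0] := posnP N; first by rewrite N0 muln0.
have sum_le : (\sum_(t <- posdiff A) line_mult A t)%:R <= k%:R * N%:R + N%:R ^+ 2 / 8 :> R.
  have const_sum (X : {fset R}) (x : R) : \sum_(t <- X) x = #|` X|%:R * x.
    by rewrite card_fset_sum1 natr_sum mulr_suml; under [RHS]eq_bigr do rewrite mul1r.
  pose w : R := N%:R `^ (1 / 8).
  have w0 : 0 <= c * w by rewrite mulr_ge0 ?powR_ge0 ?ltW.
  apply: (@le_trans _ _ (\sum_(t <- posdiff A)
      ((if c * w <= (line_mult A t)%:R then N%:R else 0) + c * w))).
    rewrite natr_sum; apply: ler_sum => t _.
    have [_|/ltW] := leP (c * w) (line_mult A t)%:R; last by rewrite add0r.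
    by rewrite ler_wpDr // ler_nat line_mult_le.
  rewrite big_split /= -big_mkcond big_fset_condE !const_sum lerD2l.
  rewrite mulrCA; apply: (@le_trans _ _ (c * (C * N%:R ^+ 2))); first by rewrite ler_pM2l.
  by rewrite mulrA; have := ler_wpM2r (exprn_ge0 2 (ler0n R N)) cC; lra.
have := sum_line_mult A; rewrite -/N => /(congr1 (fun n => n%:R : R)).
rewrite natrD natrM natrX => e.
rewrite -(ler_nat R) natrD !natrM -(ler_pM2r (_ : 0 < N%:R)) ?ltr0n //.
lra.
Qed.

End Distances.

Theorem mainTheorem2 (R : realType) (K : R) :
  exists c : R, 0 < c /\
    (forall A : {fset R},
       #|` distances (A `*` A)%fset|%:R <= K * #|` A|%:R ^+ 2 ->
       exists L : set (R * R), rich_line c A L) /\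
    (forall m : nat, exists N : nat, forall A : {fset R},
       #|` distances (A `*` A)%fset|%:R <= K * #|` A|%:R ^+ 2 ->
       (N <= #|` A|)%N ->
       exists Ls : {fset set (R * R)},
         (m <= #|` Ls|)%N /\ forall L, L \in Ls -> rich_line c A L).
Proof.
have [C C0 CP] := posdiff_bound K.
(* The bound 1 serves sets with at most one element, and 1 / (8 C) the counting of rich shifts. *)
pose c : R := Num.min 1 (1 / (8 * C)).
have c0 : 0 < c by rewrite lt_min ltr01 divr_gt0 // mulr_gt0.
have c1 : c <= 1 by rewrite ge_min lexx.
have cC : c * C <= 1 / 8.
  apply: (@le_trans _ _ (1 / (8 * C) * C)).
    by rewrite ler_pM2r // ge_min lexx orbT.
  by rewrite invfM mul1r mulfVK ?gt_eqF // mul1r.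
have many (A : {fset R}) : (0 < #|` A|)%N ->
    #|` distances (A `*` A)%fset|%:R <= K * #|` A|%:R ^+ 2 ->
    (3 * #|` A| <= 8 * #|` rich_shifts A c| + 4)%N.
  by move=> A0 AK; apply: card_rich_shifts cC _ => //; apply: CP.
have rich (A : {fset R}) t : t \in rich_shifts A c -> rich_line c A (graph_line 1 t).
  by rewrite inE => /andP[]; apply: rich_graph_line.
exists c; split => //; split => [A AK|m].
  have [A1|A2] := leqP #|` A| 1; first exact: rich_line_card_le1.
  (* Without rich shifts 3 |A| <= 4, which fails for |A| >= 2. *)
  have := many A (ltnW A2) AK.
  have [/fset0Pn[t tA] _|] := boolP (rich_shifts A c != fset0).
    by exists (graph_line 1 t); apply: rich.
  by rewrite negbK => /eqP->; rewrite cardfs0; lia.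
(* From |A| >= 4 m + 2, the count k of rich shifts satisfies 12 m + 6 <= 8 k + 4, so m <= k; the
   summand 2 also makes [A] nonempty when m = 0. *)
exists (4 * m + 2)%N => A AK NA.
exists [fset graph_line 1 t | t in rich_shifts A c]%fset; split.
  have -> : #|` [fset graph_line 1 t | t in rich_shifts A c]%fset| =
            #|` rich_shifts A c|.
    by rewrite card_imfset //; apply: graph_line_inj.
  by have := many A (leq_trans (ltn_addl _ (ltn0Sn _)) NA) AK; lia.
by move=> L /imfsetP[t /= tA ->]; apply: rich.
Qed.
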